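(* Let $n\ge1$, let $\Gamma\subset\mathbf{E}(n+1)$ be a crystallographic group with lattice $\mathcal{L}$, and let $y_0>0$. If $(0,y_0)\in\mathcal{L}$ then the group $\widetilde{\mathcal{L}}_{y_0}$ of common periods of all functions in $\Pi_{y_0}(X_\Gamma)$ is the lattice (in $\mathbb{R}^n$) $\widetilde{\mathcal{L}}_{y_0}=\mathcal{P}(\mathcal{L})\cup\mathcal{P}(\mathcal{L}_\sigma)$.
   Context: Points of $\mathbb{R}^{n+1}$ are written $(x,y)$ with $x\in\mathbb{R}^n$, $y\in\mathbb{R}$; $\mathcal{P}(x,y)=x$. A lattice in $\mathbb{R}^m$ is the set of all integer combinations of $m$ linearly independent vectors. The Euclidean group $\mathbf{E}(m)=\mathbb{R}^m\ltimes\mathbf{O}(m)$ consists of pairs $(v,\delta)$ acting by $(v,\delta)\cdot z=v+\delta z$. A crystallographic group $\Gamma\le\mathbf{E}(n+1)$ with lattice $\mathcal{L}$ is a subgroup such that $\mathcal{L}=\{v:(v,\mathrm{Id}_{n+1})\in\Gamma\}$ is a lattice in $\mathbb{R}^{n+1}$; its point group is $\mathbf{J}=\{\delta\in\mathbf{O}(n+1):(v,\delta)\in\Gamma\text{ for some }v\}$. $\sigma\in\mathbf{O}(n+1)$ is $\sigma(x,y)=(x,-y)$. $\mathcal{L}_\sigma=v_\sigma+\mathcal{L}$ if $(v_\sigma,\sigma)\in\Gamma$ (independent of the choice of $v_\sigma$), and $\mathcal{L}_\sigma=\emptyset$ if $\sigma\notin\mathbf{J}$. $X_\Gamma$ is the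 vector space of all $C^1$ functions $f:\mathbb{R}^{n+1}\to\mathbb{R}$ with $f(\gamma^{-1}\cdot(x,y))=f(x,y)$ for all $\gamma\in\Gamma$ and all $(x,y)$. $\Pi_{y_0}(f)(x)=\int_0^{y_0}f(x,y)\,dy$ for $x\in\mathbb{R}^n$, and $\Pi_{y_0}(X_\Gamma)=\{\Pi_{y_0}(f):f\in X_\Gamma\}$. $\widetilde{\mathcal{L}}_{y_0}=\{p\in\mathbb{R}^n:g(x+p)=g(x)\ \forall x\in\mathbb{R}^n,\ \forall g\in\Pi_{y_0}(X_\Gamma)\}$. *)

(* Defs.v *)
From mathcomp Require Import all_boot all_order all_algebra.
From mathcomp Require Import all_classical all_reals all_analysis.

Set Implicit Arguments.
Unset Strict Implicit.
Unset Printing Implicit Defensive.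

Import Order.TTheory GRing.Theory Num.Theory.
Import numFieldNormedType.Exports.

Local Open Scope classical_set_scope.
Local Open Scope ring_scope.

Section Euclidean.
Variables (R : realType) (m : nat).

Definition is_lattice (L : set 'cV[R]_m) : Prop :=
  exists b : m.-tuple 'cV[R]_m,
    free b /\
    L = [set v | exists c : 'I_m -> int, v = \sum_(i < m) tnth b i *~ c i].

Definition orthogonal_mx : set 'M[R]_m := [set A | A^T *m A = 1%:M].

(* The Euclidean group is carried by the set [euclidean_group] of the pairs
   (v, delta) with delta orthogonal; the operations below are total on all
   pairs and are meant to be used on that set. *)
Definition motion : Type := ('cV[R]_m * 'M[R]_m)%type.

Definition euclidean_group : set motion := [set g | orthogonal_mx g.2].

Definition act (g : motion) (z : 'cV[R]_m) : 'cV[R]_m := g.1 + g.2 *m z.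

Definition motion_one : motion := (0, 1%:M).

Definition motion_mul (g h : motion) : motion :=
  (g.1 + g.2 *m h.1, g.2 *m h.2).

Definition motion_inv (g : motion) : motion :=
  (- (invmx g.2 *m g.1), invmx g.2).

Definition is_subgroup (G : set motion) : Prop :=
  [/\ G `<=` euclidean_group,
      G motion_one,
      forall g h, G g -> G h -> G (motion_mul g h)
    & forall g, G g -> G (motion_inv g)].

Definition lattice_of (G : set motion) : set 'cV[R]_m :=
  [set v | G (v, 1%:M)].

Definition crystallographic (G : set motion) : Prop :=
  is_subgroup G /\ is_lattice (lattice_of G).

Lemma act_one z : act motion_one z = z.
Proof. by rewrite /act add0r mul1mx. Qed.

Lemma act_mul g h z : act (motion_mul g h) z = act g (act h z).
Proof. by rewrite /act /= mulmxDr addrA mulmxA. Qed.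

Lemma act_inv g z : euclidean_group g -> act (motion_inv g) (act g z) = z.
Proof.
move=> /mulmx1_unit[_ g2U].
by rewrite /act /= mulmxDr addrA addNr add0r mulKmx.
Qed.

End Euclidean.

Section Projection.
Variables (R : realType) (n : nat).

(* The last coordinate of R^(n+1), of index [ord_max], plays the role of y. *)
Definition pt (x : 'cV[R]_n) (y : R) : 'cV[R]_n.+1 :=
  \col_i (if unlift ord_max i is Some j then x j 0 else y).

Definition projx (z : 'cV[R]_n.+1) : 'cV[R]_n := row' ord_max z.

Definition sigma : 'M[R]_n.+1 :=
  diag_mx (\row_j (if j == ord_max then -1 else 1)).

Lemma projx_pt x y : projx (pt x y) = x.
Proof. by apply/colP => i; rewrite !mxE liftK. Qed.

Lemma pt_last x y : pt x y ord_max 0 = y.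
Proof. by rewrite mxE unlift_none. Qed.

Lemma pt_eta z : pt (projx z) (z ord_max 0) = z.
Proof. by apply/colP => i; rewrite !mxE; case: unliftP => [j|] -> //; rewrite !mxE. Qed.

Lemma sigma_pt x y : sigma *m pt x y = pt x (- y).
Proof.
apply/colP => i; rewrite mul_diag_mx !mxE.
case: unliftP => [j ->|->]; last by rewrite eqxx mulN1r.
by rewrite eq_sym (negbTE (neq_lift _ _)) mul1r.
Qed.

Variable G : set (motion R n.+1).

(* v_sigma + L for a v_sigma with (v_sigma, sigma) in G: the union over all
   such v_sigma is a union of copies of the same set, and is empty when there
   is none. *)
Definition lattice_sigma : set 'cV[R]_n.+1 :=
  [set w | exists v, G (v, sigma) /\ exists l, lattice_of G l /\ w = v + l].

(* In finite dimension, continuity of the differential is continuity of its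
   value at each fixed vector. *)
Definition C1 (f : 'cV[R]_n.+1 -> R) : Prop :=
  (forall z, differentiable f z) /\
  (forall v, continuous (fun z => 'd f z v)).

Definition invariant_functions : set ('cV[R]_n.+1 -> R) :=
  [set f | C1 f /\
     forall g, G g -> forall z, f (act (motion_inv g) z) = f z].

Definition Pi (y0 : R) (f : 'cV[R]_n.+1 -> R) : 'cV[R]_n -> R :=
  fun x => (\int[lebesgue_measure]_(y in `[0, y0]) f (pt x y))%R.

Definition common_periods (y0 : R) : set 'cV[R]_n :=
  [set p | forall x h, (Pi y0 @` invariant_functions) h -> h (x + p) = h x].

End Projection.

(* Main.v *)
Require Import Defs.
From HB Require Import structures.
From mathcomp Require Import all_boot all_order all_algebra.
From mathcomp Require Import all_classical all_reals all_analysis.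
From mathcomp Require Import lra.

Import Order.TTheory GRing.Theory Num.Theory.
Import numFieldNormedType.Exports.

Local Open Scope classical_set_scope.
Local Open Scope ring_scope.

(** Write L for the lattice of G and J for its point group.

    Elements of the right-hand side are periods.  Every invariant f has the
    vertical period y0, since (0, y0) lies in L.  A translation (p, q) of L
    gives f (x + p, y) = f (x, y - q), and an element ((p, q), sigma) of G gives
    f (x + p, y) = f (x, q - y).  Integrating over one full vertical period
    absorbs the shift and the reflection ([Rintegral_periodic],
    [Rintegral_periodic_reflect]).

    Conversely, let p be outside the right-hand side.  An invariant function
    is built that is concentrated near the orbit of one point z0: its integral
    over the vertical line above x0 = projx z0 is positive, while it vanishes
    on the segment above x0 + p.  All that is needed is that no element of G
    moves z0 to the line above x0 + p.  That (v, d) does so means that z0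
    solves n affine equations, whose linear parts are the first n rows of
    d - 1.  If these rows all vanish, orthogonality forces d
    to be 1 or sigma ([orthogonal_fix_proj]), the equations read p = projx v,
    and p would be in the right-hand side.  Otherwise z0 has to avoid a proper
    affine hyperplane.  Since G is countable, some point of the moment curve
    avoids all these hyperplanes at once ([generic_moment_curve]), because the
    curve meets each of them finitely often.  The function is then
    sum over d in J of cutoff (e - gap (g_d^-1 z - z0)), where g_d is an
    element of G with linear part d, gap is an L-periodic smooth function that
    vanishes exactly on L, and e is the minimum of finitely many positive
    minima over a compact segment ([orbit_separation]).  The sum is finite,
    since in a basis of L the elements of J are integer matrices with bounded
    entries ([finite_point_group]).

    That the right-hand side is a lattice is a separate matter.  The vector
    (0, y0) is a multiple of the first vector of some basis of L, so the other
    basis vectors project to a basis of projx L ([lattice_projx]).  If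
    (w, sigma) is in G then so is its square, whose translation part projects
    to 2 projx w; hence the union is projx L with a half of one of its own
    vectors adjoined, again a lattice by the Smith normal form
    ([lattice_setU_half]). *)

Set Implicit Arguments.
Unset Strict Implicit.
Unset Printing Implicit Defensive.

(** * Integrals over one period *)

Section RealLine.
Variable R : realType.
Implicit Types (g : R -> R) (a b q T : R).
Notation mu := (@lebesgue_measure R).

Lemma continuous_itv_integrable g a b :
  continuous g -> mu.-integrable `[a, b] (EFin \o g).
Proof.
move=> cg; apply: continuous_compact_integrable; first exact: segment_compact.
exact: continuous_subspaceT.
Qed.

Lemma Rintegral_shift g a b q : a <= b -> continuous g ->
  \int[mu]_(y in `[a + q, b + q]) g y = \int[mu]_(y in `[a, b]) g (y + q).
Proof.
move=> ab cg; rewrite /Rintegral; congr fine.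
have dF x : is_derive x (1 : R) (fun y : R => y + q) 1.
  by apply: is_derive_eq; rewrite addr0.
have F'E : derive1 (fun y : R => y + q) = cst 1.
  by apply/funext => x; rewrite derive1E derive_val.
have cF : continuous (fun y : R => y + q).
  by move=> x; apply: cvgD; [exact: cvg_id|exact: cvg_cst].
rewrite (@integration_by_substitution_increasing _ (fun y => y + q))//.
- apply: eq_integral => x _; congr EFin.
  by rewrite F'E !fctE mulr1.
- by move=> x y _ _; rewrite ltrD2r.
- by move=> x _; rewrite F'E; exact: cvg_cst.
- by rewrite F'E; exact: is_cvg_cst.
- by rewrite F'E; exact: is_cvg_cst.
- split => //.
  + exact: cvg_at_right_filter (cF _).
  + exact: cvg_at_left_filter (cF _).
- exact: continuous_subspaceT.
Qed.

Lemma Rintegral_opp g a b : a <= b -> continuous g ->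
  \int[mu]_(y in `[- b, - a]) g y = \int[mu]_(y in `[a, b]) g (- y).
Proof.
move=> ab cg; rewrite /Rintegral integration_by_substitution_oppr//.
exact: continuous_subspaceT.
Qed.

Lemma Rintegral_cat g a b c : a <= b <= c -> continuous g ->
  \int[mu]_(y in `[a, c]) g y =
  \int[mu]_(y in `[a, b]) g y + \int[mu]_(y in `[b, c]) g y.
Proof.
move=> /andP[ab bc] cg.
rewrite -[X in _ + X]Rintegral_itv_obnd_cbnd; last first.
  apply: integrableS (continuous_itv_integrable b c cg) => //.
  exact: subset_itv_oc_cc.
rewrite -(@Rintegral_itvB _ _ (BLeft a)) ?bnd_simp//.
  by rewrite addrC subrK.
exact: continuous_itv_integrable.
Qed.

Lemma continuous_shift g q : continuous g -> continuous (fun y => g (y + q)).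
Proof.
move=> cg x; apply: continuous_comp; last exact: cg.
by apply: cvgD; [exact: cvg_id|exact: cvg_cst].
Qed.

(** For q >= 0, both integrals become equal once the integral over [0, q] is
    added: it equals the one over [T, T + q], by periodicity.  A negative q is
    reduced to this case by applying it to the translate of g by q. *)
Lemma Rintegral_periodic g T q : 0 < T -> continuous g ->
  (forall y, g (y + T) = g y) ->
  \int[mu]_(y in `[0, T]) g (y + q) = \int[mu]_(y in `[0, T]) g y.
Proof.
move=> T0; wlog q0 : g q / 0 <= q => [H cg gT|cg gT].
  case: (leP 0 q) => [q0|/ltW q0]; first exact: H.
  rewrite -[LHS](H (fun y => g (y + q)) (- q)) ?oppr_ge0//.
  - by apply: eq_Rintegral => y _; rewrite subrK.
  - exact: continuous_shift.
  - by move=> y; rewrite addrAC gT.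
rewrite -(Rintegral_shift _ (ltW T0))// add0r.
apply: (@addrI _ (\int[mu]_(y in `[0, q]) g y)).
rewrite -Rintegral_cat//; last by rewrite q0 lerDr ltW.
rewrite (@Rintegral_cat _ _ T)//; last by rewrite (ltW T0) lerDl.
rewrite addrC; congr (_ + _).
rewrite -{1}[T]add0r [T + q]addrC Rintegral_shift//.
by apply: eq_Rintegral => y _; rewrite gT.
Qed.

Lemma Rintegral_periodic_reflect g T q : 0 < T -> continuous g ->
  (forall y, g (y + T) = g y) ->
  \int[mu]_(y in `[0, T]) g (q - y) = \int[mu]_(y in `[0, T]) g y.
Proof.
move=> T0 cg gT.
have cg' := @continuous_shift g q cg.
transitivity (\int[mu]_(y in `[- T, - 0]) g (y + q)).
  by rewrite Rintegral_opp ?ltW//; apply: eq_Rintegral => y _; rewrite addrC.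
rewrite -(@Rintegral_periodic g T q)// oppr0.
rewrite -(@Rintegral_periodic (fun y => g (y + q)) T (- T))//; last first.
  by move=> y; rewrite addrAC gT.
by rewrite -(Rintegral_shift (- T) (ltW T0) cg')// add0r subrr.
Qed.

(** A continuous function exceeds half of its value at c on a small segment
    around c, which already contributes a positive amount. *)
Lemma Rintegral_gt0 g T c : continuous g -> (forall y, 0 <= g y) ->
  0 < c < T -> 0 < g c -> 0 < \int[mu]_(y in `[0, T]) g y.
Proof.
move=> cg g0 /andP[c0 cT] gc0.
have [e e0 He] : exists2 e, 0 < e &
    forall y, c - e <= y <= c + e -> g c / 2 <= g y.
  have gc2 : g c / 2 < g c by rewrite ltr_pdivrMr// ltr_pMr// ltr1n.
  have /cvgrPdist_le/(_ (g c / 2)) := cg c.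
  rewrite divr_gt0// => /(_ isT) /nbhs_ballP[d /= d0 Hd].
  exists (d / 2); first by rewrite divr_gt0.
  move=> y yc; have /Hd /= : ball c d y.
    by rewrite /ball/= ltr_distlC; lra.
  by rewrite ler_distl; lra.
pose d := Num.min e (Num.min c (T - c)).
have d0 : 0 < d by rewrite !lt_min e0 c0 subr_gt0.
have /andP[de /andP[dc dT]] : [&& d <= e, d <= c & d <= T - c].
  by rewrite !ge_min !lexx !orbT.
have cd0 : 0 <= c - d <= T by apply/andP; split; lra.
have cd1 : c - d <= c + d <= T by apply/andP; split; lra.
rewrite (Rintegral_cat cd0 cg) (Rintegral_cat cd1 cg).
apply: ltr_wpDl; first exact: Rintegral_ge0.
apply: ltr_wpDr; first exact: Rintegral_ge0.
apply: (@lt_le_trans _ _ (\int[mu]_(y in `[c - d, c + d]) (g c / 2))).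
  rewrite Rintegral_cst//= lebesgue_measure_itv/= lte_fin ifT; last lra.
  by rewrite -EFinB/= mulr_gt0 ?divr_gt0//; lra.
apply: le_Rintegral => //; try exact: continuous_itv_integrable.
  by apply: continuous_itv_integrable => y; exact: cvg_cst.
by move=> y /=; rewrite in_itv/= => yd; apply: He; lra.
Qed.

End RealLine.

(** * Functions of class C1 and a cutoff *)

Section C1Functions.
Variables (R : realType) (n : nat).
Implicit Types f : 'cV[R]_n.+1 -> R.

Lemma C1_continuous f : C1 f -> continuous f.
Proof. by move=> [df _] z; exact: differentiable_continuous. Qed.

Lemma C1_cst (a : R) : @C1 R n (cst a).
Proof.
split=> [z|v]; first exact: differentiable_cst.
rewrite (_ : (fun z => _) = cst 0); first exact: cst_continuous.
by apply/funext => z; rewrite diff_cst.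
Qed.

Lemma C1_add f1 f2 : C1 f1 -> C1 f2 -> C1 (f1 + f2).
Proof.
move=> [d1 c1] [d2 c2]; split=> [z|v]; first exact: differentiableD.
rewrite (_ : (fun z => _) = (fun z => 'd f1 z v + 'd f2 z v)).
  by move=> z; exact: cvgD (c1 v z) (c2 v z).
apply/funext => z; have E := diffD (d1 z) (d2 z).
exact: (congr1 (fun h => h v) E).
Qed.

Lemma C1_sum (I : Type) (s : seq I) (F : I -> 'cV[R]_n.+1 -> R) :
  (forall i, C1 (F i)) -> C1 (fun z => \sum_(i <- s) F i z).
Proof.
move=> cF; elim: s => [|i s IHs].
  by under eq_fun do rewrite big_nil; exact: C1_cst.
by under eq_fun do rewrite big_cons; exact: (C1_add (cF i) IHs).
Qed.

(** By the chain rule the differential at z along v is a product of two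
    continuous functions of z. *)
Lemma C1_comp (g g' : R -> R) f : (forall t, is_derive t (1 : R) g (g' t)) ->
  continuous g' -> C1 f -> C1 (g \o f).
Proof.
move=> dg cg' C1f; have [df cf] := C1f.
have diffg t : differentiable g t by apply/derivable1_diffP.
split=> [z|v]; first exact: differentiable_comp.
rewrite (_ : (fun z => _) = (fun z => 'd f z v * g' (f z))).
  move=> z; apply: cvgM (cf v z) _.
  have : continuous_at z (g' \o f).
    by apply: continuous_comp; [exact: C1_continuous|exact: cg'].
  exact.
apply/funext => z; have E := diff_comp (df z) (diffg (f z)).
have -> : g' (f z) = derive1 g (f z) by rewrite derive1E derive_val.
rewrite (congr1 (fun h => h v) E) /=.
exact: (congr1 (fun h => h ('d f z v)) (diff1E (diffg (f z)))).
Qed.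

Lemma C1_coord i : C1 (fun z : 'cV[R]_n.+1 => z i 0).
Proof.
have lin : linear (fun z : 'cV[R]_n.+1 => z i 0 : R).
  by move=> a u v; rewrite !mxE.
pose cM := GRing.isLinear.Build _ _ _ _ _ lin.
pose c : {linear 'cV[R]_n.+1 -> R} :=
  HB.pack (fun z : 'cV[R]_n.+1 => z i 0 : R) cM.
split=> [z|v]; first exact: differentiable_coord.
rewrite (_ : (fun z => _) = cst (v i 0)); first exact: cst_continuous.
apply/funext => z; have := @diff_lin _ _ _ c z (@coord_continuous _ _ _ i 0).
by move=> /(congr1 (fun h => h v)).
Qed.

Lemma C1_affine (u : 'rV[R]_n.+1) (a : R) : C1 (fun z => a + (u *m z) 0 0).
Proof.
apply: (C1_add (C1_cst a)).
under eq_fun do rewrite mxE.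
apply: C1_sum => i.
apply: (@C1_comp ( *%R (u 0 i)) (cst (u 0 i))) (C1_coord i) => [t|].
  by apply: is_derive_eq; exact: mulr1.
exact: cst_continuous.
Qed.

End C1Functions.

Section Cutoff.
Variable R : realType.

(** The square of the positive part is the simplest C1 function that is
    positive for t > 0 and zero for t <= 0. *)
Definition cutoff (t : R) : R := Num.max 0 t ^+ 2.

Lemma cutoff_ge0 t : 0 <= cutoff t.
Proof. exact: sqr_ge0. Qed.

Lemma cutoff_gt0 t : 0 < t -> 0 < cutoff t.
Proof. by move=> t0; rewrite /cutoff max_r ?exprn_gt0// ltW. Qed.

Lemma cutoff_eq0 t : t <= 0 -> cutoff t = 0.
Proof. by move=> t0; rewrite /cutoff max_l// expr0n. Qed.

(** A first-order expansion with a uniform quadratic error, so that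
    differentiability needs no separate treatment of the point 0. *)
Lemma cutoff_taylor t s :
  `|cutoff (s + t) - cutoff t - s * (2 * Num.max 0 t)| <= s ^+ 2.
Proof.
rewrite /cutoff ler_norml; case: (leP 0 t) => t0.
  case: (leP 0 (s + t)) => st; apply/andP; split; nra.
case: (leP 0 (s + t)) => st; apply/andP; split; nra.
Qed.

Lemma continuous_max0 : continuous (fun t : R => Num.max 0 t).
Proof.
move=> t; apply: continuous_max; first exact: cst_continuous.
exact: cvg_id.
Qed.

Lemma is_derive_cutoff t : is_derive t (1 : R) cutoff (2 * Num.max 0 t).
Proof.
have H : (fun h => h^-1 *: ((cutoff \o shift t) (h *: 1) - cutoff t)) @ 0^'
           --> 2 * Num.max 0 t.
  apply/cvgrPdist_le => e e0; near=> h.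
  have h0 : h != 0 by near: h; exact: nbhs_dnbhs_neq.
  have he : `|h| <= e by near: h; apply: dnbhs0_le.
  rewrite /= [h%:A]mulr1 distrC.
  rewrite -(@ler_pM2l _ `|h|) ?normr_gt0// -normrM.
  rewrite mulrBr [_ *: _]/(_ * _) mulVKf//.
  apply: le_trans (cutoff_taylor _ _) _.
  by rewrite -real_normK ?num_real// expr2 ler_wpM2l.
apply: DeriveDef; last exact: cvg_lim H.
by apply/cvg_ex; exists (2 * Num.max 0 t).
Unshelve. all: by end_near. Qed.

Lemma C1_cutoff n (f : 'cV[R]_n.+1 -> R) : C1 f -> C1 (cutoff \o f).
Proof.
apply: C1_comp; first exact: is_derive_cutoff.
by move=> t; apply: cvgM; [exact: cvg_cst|exact: continuous_max0].
Qed.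

End Cutoff.

(** * Lattices in coordinates *)

Section Lattices.
Variable R : realType.
Local Notation intmx := (map_mx (intr : int -> R)).

Lemma intmxM m n p (A : 'M[int]_(m, n)) (B : 'M[int]_(n, p)) :
  intmx (A *m B) = intmx A *m intmx B.
Proof. exact: map_mxM. Qed.

Definition span_int m k (B : 'M[R]_(m, k)) : set 'cV[R]_m :=
  [set v | exists c : 'cV[int]_k, v = B *m intmx c].

Lemma mulmx_col_sum m k (B : 'M[R]_(m, k)) (c : 'cV[R]_k) :
  B *m c = \sum_j c j 0 *: col j B.
Proof.
apply/colP => i; rewrite mxE summxE; apply: eq_bigr => j _.
by rewrite !mxE mulrC.
Qed.

Lemma unitmx_col_inj m (B : 'M[R]_m) :
  (forall c : 'cV[R]_m, B *m c = 0 -> c = 0) -> B \in unitmx.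
Proof.
move=> Binj; rewrite -unitmx_tr -row_free_unit -kermx_eq0.
apply/eqP/row_matrixP => i; rewrite row0.
apply: trmx_inj; rewrite trmx0; apply: Binj; apply: trmx_inj.
by rewrite trmx_mul trmxK trmx0 -row_mul mulmx_ker row0.
Qed.

(** The matrix form of a lattice: bases are invertible matrices, and changes of
    basis, projections and sums of lattices become integer matrix algebra. *)
Lemma is_latticeP m (L : set 'cV[R]_m) :
  is_lattice L <-> exists2 B : 'M[R]_m, B \in unitmx & L = span_int B.
Proof.
have spanE (B : 'M[R]_m) (b : m.-tuple 'cV[R]_m) :
    (forall j, tnth b j = col j B) ->
    [set v | exists c : 'I_m -> int, v = \sum_(i < m) tnth b i *~ c i] =
    span_int B.
  move=> bB; apply/seteqP; split=> v [c ->].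
    exists (\col_i c i); rewrite mulmx_col_sum; apply: eq_bigr => j _.
    by rewrite bB !mxE scaler_int.
  exists (fun i => c i 0); rewrite mulmx_col_sum; apply: eq_bigr => j _.
  by rewrite bB !mxE scaler_int.
split=> [[b [bfree ->]]|[B Bu ->]].
  pose B : 'M[R]_m := \matrix_(i, j) tnth b j i 0.
  have bB j : tnth b j = col j B by apply/colP => i; rewrite !mxE.
  exists B; last exact: spanE.
  apply: unitmx_col_inj => c Bc0.
  apply/colP => j; rewrite mxE.
  have /freeP/(_ (fun i => c i 0)) := bfree; apply.
  rewrite -[RHS]Bc0 mulmx_col_sum; apply: eq_bigr => i _.
  by rewrite -bB (tnth_nth 0).
pose b := [tuple col j B | j < m].
have bB j : tnth b j = col j B by rewrite tnth_mktuple.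
exists b; split; last by rewrite (spanE B).
apply/freeP => k kb0 i.
have : B *m (\col_i k i) = 0.
  rewrite -[RHS]kb0 mulmx_col_sum; apply: eq_bigr => j _.
  by rewrite -tnth_nth bB mxE.
move=> /(congr1 (mulmx (invmx B))); rewrite mulKmx// mulmx0.
by move=> /colP/(_ i); rewrite !mxE.
Qed.

Lemma intmx_unit m (U : 'M[int]_m) : U \in unitmx -> intmx U \in unitmx.
Proof. by rewrite !unitmxE det_map_mx; exact: rmorph_unit. Qed.

(** An integer matrix with an integer right inverse is onto as a map of
    integer vectors; for square E this is a change of basis. *)
Lemma span_intM m k (B : 'M[R]_(m, k)) l (E : 'M[int]_(k, l))
    (F : 'M[int]_(l, k)) :
  E *m F = 1%:M -> span_int (B *m intmx E) = span_int B.
Proof.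
move=> EF; apply/seteqP; split=> v [c ->].
  by exists (E *m c); rewrite intmxM mulmxA.
by exists (F *m c); rewrite -mulmxA -intmxM mulmxA EF mul1mx.
Qed.

(** Finitely many generators with rational coordinates in a common basis (here
    C, which absorbs the common denominator) span a lattice as soon as they
    have full rank.  In the Smith normal form A = U D V, the unimodular V does
    not change the span and the square part of U D is the new basis. *)
Lemma lattice_of_generators m k (C : 'M[R]_m) (A : 'M[int]_(m, k)) :
  C \in unitmx -> row_free (intmx A) -> is_lattice (span_int (C *m intmx A)).
Proof.
move=> Cu Afree; have [U Uu [V Vu [d _ AE]]] := int_Smith_normal_form A.
have mk : (m <= k)%N by rewrite -(eqP Afree) rank_leq_col.
pose D : 'M[int]_m := \matrix_(i, j) (d`_i *+ (i == j :> nat)).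
(* The m x k diagonal of the normal form is D followed by zero columns. *)
pose P : 'M[int]_(m, k) := pid_mx m.
have DP : \matrix_(i < m, j < k) (d`_i *+ (i == j :> nat)) = D *m P.
  apply/matrixP => i j; rewrite !mxE (bigD1 i)//= !mxE eqxx mulr1n.
  rewrite big1 ?addr0 ?ltn_ord ?andbT; last first.
    move=> l li; rewrite !mxE; case: eqVneq => [/val_inj il|_].
      by rewrite il eqxx in li.
    by rewrite mulr0n mul0r.
  by rewrite mulr_natr.
rewrite DP in AE; have {}AE : A = (U *m D) *m (P *m V) by rewrite AE !mulmxA.
have UDu : intmx (U *m D) \in unitmx.
  rewrite -row_free_unit /row_free eqn_leq rank_leq_row/=.
  by rewrite -{1}(eqP Afree) AE intmxM mxrankM_maxl.
apply/is_latticeP; exists (C *m intmx (U *m D)).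
  by rewrite unitmx_mul Cu UDu.
rewrite AE intmxM mulmxA.
apply: (@span_intM _ _ _ _ _ (invmx V *m pid_mx m)).
rewrite mulmxA mulmxK// mul_pid_mx !minnn (minn_idPr mk).
exact: pid_mx_1.
Qed.

(** Every lattice vector is an integer multiple of a member of some basis: the
    Smith normal form of its coordinate column is supported on the first
    entry. *)
Lemma lattice_primitive n (L : set 'cV[R]_n.+1) v : is_lattice L -> L v ->
  exists (B : 'M[R]_n.+1) (k : int),
    [/\ B \in unitmx, L = span_int B & v = k%:~R *: col 0 B].
Proof.
move=> /is_latticeP[B Bu ->] [c ->].
have [U Uu [V Vu [d _ cE]]] := int_Smith_normal_form c.
exists (B *m intmx U), (d`_0 * V 0 0); split.
- by rewrite unitmx_mul Bu intmx_unit.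
- by rewrite (@span_intM _ _ _ _ _ (invmx U))// mulmxV.
rewrite colE -mulmxA scalemxAr; congr (B *m _).
rewrite cE -mulmxA intmxM scalemxAr; congr (_ *m _).
apply/colP => i; rewrite !mxE big_ord1 !mxE.
rewrite -[nat_of_ord i == _]/(i == 0) eqxx andbT.
case: eqVneq => [->|_]; first by rewrite mulr1n mulr1.
by rewrite mulr0n mul0r mulr0.
Qed.

Lemma projx_mul n m (B : 'M[R]_(n.+1, m)) (c : 'cV[R]_m) :
  projx (B *m c) = row' ord_max B *m c.
Proof.
by apply/colP => i; rewrite !mxE; apply: eq_bigr => j _; rewrite !mxE.
Qed.

(** A general projection of a lattice need not be discrete.  Here the kernel of
    projx is spanned by a lattice vector, which is a multiple of the first
    vector of a suitable basis ([lattice_primitive]); the projections of the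
    other basis vectors are then independent, since a vector with zero
    projection is a multiple of the first basis vector. *)
Lemma lattice_projx n (L : set 'cV[R]_n.+1) (y0 : R) :
  is_lattice L -> y0 != 0 -> L (pt 0 y0) -> is_lattice (@projx R n @` L).
Proof.
move=> Llat y00 /(lattice_primitive Llat)[B [k [Bu -> ptE]]].
(* The columns of M are the projections of all basis vectors but the first. *)
pose M : 'M[R]_n := col' 0 (row' ord_max B).
have k0 : k%:~R != 0 :> R.
  apply: contra_neq y00 => k0.
  by rewrite -(pt_last (0 : 'cV[R]_n) y0) ptE k0 scale0r mxE.
have col0 i : row' ord_max B i 0 = 0.
  have := congr1 (fun z => projx z i 0) ptE.
  rewrite projx_pt !mxE => /esym/eqP; rewrite mulf_eq0 (negPf k0) /=.
  by move/eqP.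
have BM (c : 'cV[R]_n.+1) : projx (B *m c) = M *m row' 0 c.
  rewrite projx_mul; apply/colP => i; rewrite !mxE big_ord_recl.
  rewrite col0 mul0r add0r; apply: eq_bigr => j _.
  by rewrite !mxE; congr (B _ _ * c _ _); apply/val_inj; rewrite /= /bump.
apply/is_latticeP; exists M.
  apply: unitmx_col_inj => c Mc0.
  pose c' : 'cV[R]_n.+1 := \col_i (if unlift 0 i is Some j then c j 0 else 0).
  have c'E : row' 0 c' = c by apply/colP => j; rewrite !mxE liftK.
  have := BM c'; rewrite c'E Mc0 => pBc'.
  have Bc' : B *m c' = (((B *m c') ord_max 0 / y0) * k%:~R) *: col 0 B.
    rewrite -scalerA -ptE -{1}[B *m c']pt_eta pBc'.
    apply/colP => i; rewrite !mxE; case: unliftP => [j _|_].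
      by rewrite mxE mulr0.
    by rewrite divfK.
  move: Bc'; rewrite colE scalemxAr => /(congr1 (mulmx (invmx B))).
  rewrite !mulKmx// => /(congr1 (row' 0)); rewrite c'E => ->.
  (* So c' is a multiple of delta_mx 0 0, as B is injective. *)
  apply/colP => i; rewrite !mxE [lift _ _ == _]eq_sym.
  by rewrite (negPf (neq_lift _ _)) mulr0.
apply/seteqP; split=> [_ [_ [c ->] <-]|v [c ->]].
  exists (row' 0 c); rewrite BM; congr (_ *m _).
  by apply/colP => j; rewrite !mxE.
exists (B *m intmx (\col_i (if unlift 0 i is Some j then c j 0 else 0))).
  by exists (\col_i (if unlift 0 i is Some j then c j 0 else 0)).
rewrite BM; congr (_ *m _).
by apply/colP => j; rewrite !mxE liftK.
Qed.

(** If M is a basis of L and w + w = M a, the union is generated by the columns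
    of M and w, that is, by the matrix (2 I | a) in the basis M / 2. *)
Lemma lattice_setU_half n (L : set 'cV[R]_n) w :
  is_lattice L -> L (w + w) -> is_lattice (L `|` [set w + l | l in L]).
Proof.
move=> /is_latticeP[M Mu ->] [a wwE].
have two : (2 : R) != 0 by rewrite pnatr_eq0.
pose C := 2^-1 *: M; pose A : 'M[int]_(n, n + 1) := row_mx 2%:M a.
have wE : w = C *m intmx a.
  rewrite -scalemxAl -wwE -mulr2n -[w *+ 2]scaler_nat scalerA mulVf//.
  by rewrite scale1r.
have CA (c : 'cV[int]_(n + 1)) : C *m intmx A *m intmx c =
    M *m intmx (usubmx c) + (dsubmx c 0 0)%:~R *: w.
  rewrite -mulmxA -intmxM -{1}(vsubmxK c) mul_row_col map_mxD mulmxDr.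
  congr (_ + _).
    rewrite mul_scalar_mx map_mxZ -scalemxAr -scalemxAl scalerA.
    by rewrite mulfV// scale1r.
  rewrite wE intmxM mulmxA {1}[dsubmx c]mx11_scalar.
  by rewrite map_scalar_mx mul_mx_scalar.
have -> : span_int M `|` [set w + l | l in span_int M] =
    span_int (C *m intmx A).
  apply/seteqP; split=> [v [[c ->]|[_ [c ->] <-]]|v [c ->]].
  - exists (col_mx c 0); rewrite CA col_mxKu col_mxKd mxE.
    by rewrite scale0r addr0.
  - exists (col_mx c 1%:M); rewrite CA col_mxKu col_mxKd mxE mulr1n.
    by rewrite scale1r addrC.
  - rewrite CA; set x := usubmx c; set t := dsubmx c 0 0.
    have [q [r ->]] : exists (q : int) (r : bool), t = q * 2 + r%:Z.
      exists (t %/ 2)%Z, ((t %% 2)%Z == 1).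
      rewrite {1}(divz_eq t 2); congr (_ + _).
      have := ltz_pmod t (isT : 0 < 2 :> int).
      have := modz_ge0 t (isT : 2 != 0 :> int).
      by case: (t %% 2)%Z => [[|[|]]|].
    have -> : (q * 2 + r%:Z)%:~R *: w = M *m intmx (q *: a) + r%:R *: w.
      rewrite rmorphD rmorphM/= scalerDl -scalerA; congr (_ + _).
      by rewrite scaler_nat mulr2n wwE map_mxZ -scalemxAr.
    rewrite addrA -mulmxDr -map_mxD; case: r.
      right; exists (M *m intmx (x + q *: a)); first by exists (x + q *: a).
      by rewrite scale1r addrC.
    by left; exists (x + q *: a); rewrite scale0r addr0.
apply: lattice_of_generators.
  by rewrite unitmxZ// unitfE invr_eq0.
apply/row_freeP; exists (col_mx (2^-1)%:M 0).
rewrite map_row_mx mul_row_col mulmx0 addr0 map_scalar_mx -scalar_mxM.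
by rewrite mulfV.
Qed.

End Lattices.

(** * Generic points on the moment curve *)

Section Generic.
Variables (R : realType) (m : nat).

Lemma finite_roots (p : {poly R}) : p != 0 -> finite_set [set t | root p t].
Proof.
move=> p0; apply: contrapT => /(infinite_set_fset (size p))[B Bp].
apply/negP; rewrite -ltnNge; apply: max_poly_roots => //.
  by apply/allP => t /Bp.
exact: finmap.fset_uniq.
Qed.

(** The exponents start at 1, so that the constant term of an affine form
    cannot cancel the contribution of its linear part. *)
Definition moment_curve (t : R) : 'cV[R]_m := \col_(i < m) t ^+ i.+1.

(** An affine form u z - c with u <> 0 restricts to the curve as a nonzero
    polynomial in t, so it has finitely many zeros there.  Countably many
    finite sets do not cover the interval ]0, T[, which has positive
    measure. *)
Lemma generic_moment_curve (S : set ('rV[R]_m * R)) (T : R) :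
  countable S -> (forall uc, S uc -> uc.1 != 0) -> 0 < T ->
  exists2 t, 0 < t < T &
    forall uc, S uc -> (uc.1 *m moment_curve t) 0 0 != uc.2.
Proof.
move=> Scnt Snz T0; apply: contrapT => noT.
pose pol (uc : 'rV[R]_m * R) : {poly R} :=
  (\poly_(i < m) (if insub i is Some j then uc.1 0 j else 0)) * 'X - uc.2%:P.
have polE uc t : (pol uc).[t] = (uc.1 *m moment_curve t) 0 0 - uc.2.
  rewrite !hornerE horner_poly mxE mulr_suml; congr (_ - _).
  apply: eq_bigr => i _; rewrite valK mxE.
  by rewrite -mulrA -exprSr.
have pol0 uc : S uc -> pol uc != 0.
  move=> /Snz; apply: contra_neq => pol0; apply/rowP => j; rewrite mxE.
  have := congr1 (fun p : {poly R} => p`_j.+1) pol0.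
  by rewrite coefB coefMX coefC coef_poly ltn_ord valK subr0 coef0.
have : countable (`]0, T[%classic : set R).
  apply: (@sub_countable _ _ _ (\bigcup_(uc in S) [set t | root (pol uc) t])).
    apply: subset_card_le => t; rewrite /= in_itv/= => t0T.
    apply: contrapT => nt; apply: noT; exists t => // uc Suc.
    apply: contra_notN nt => /eqP uct; exists uc => //=.
    by rewrite /root polE uct subrr.
  apply: bigcup_countable => // uc Suc; apply: finite_set_countable.
  exact/finite_roots/pol0.
move=> /countable_lebesgue_measure0/eqP.
by rewrite lebesgue_measure_itv/= lte_fin T0 sube0 eqe gt_eqF.
Qed.

End Generic.

(** * The point group *)

Section PointGroup.
Variables (R : realType) (m : nat) (G : set (motion R m)).
Hypothesis hG : crystallographic G.
Local Notation intmx := (map_mx (intr : int -> R)).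

Definition point_group : set 'M[R]_m := [set d | exists v, G (v, d)].

Lemma point_group_section :
  exists v : 'M[R]_m -> 'cV[R]_m, forall d, point_group d -> G (v d, d).
Proof.
have : forall d, exists v, point_group d -> G (v, d).
  by move=> d; have [[v Gv]|nJ] := pselect (point_group d); [exists v|exists 0].
by move=> /choice[v vG]; exists v.
Qed.

Lemma act_invE (g : motion R m) z :
  act (motion_inv g) z = invmx g.2 *m (z - g.1).
Proof. by rewrite /act /= mulmxBr addrC. Qed.

Lemma point_group_unit d : point_group d -> d \in unitmx.
Proof.
case: hG => -[sub _ _ _] _ [v /sub]; rewrite /euclidean_group/= => dd.
by have [] := mulmx1_unit dd.
Qed.

(** Conjugating the translation by l with (v, d) gives the translation by
    d l. *)
Lemma point_group_lattice d l :
  point_group d -> lattice_of G l -> lattice_of G (d *m l).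
Proof.
move=> Jd; have du := point_group_unit Jd; case: Jd => v Gd Gl.
have [[_ _ GM GV] _] := hG; rewrite /lattice_of/=.
have := GM _ _ (GM _ _ Gd Gl) (GV _ Gd).
rewrite /motion_mul/= mulmx1 mulmxN mulmxV// mulmxA mulmxV// mul1mx.
by rewrite addrAC subrr add0r.
Qed.

Lemma point_group_inv d : point_group d -> point_group (invmx d).
Proof.
move=> [v Gd]; have [[_ _ _ GV] _] := hG.
by exists (- (invmx d *m v)); exact: (GV _ Gd).
Qed.

Lemma lattice_diff u v d : G (u, d) -> G (v, d) -> lattice_of G (u - v).
Proof.
move=> Gu Gv; have du := point_group_unit (ex_intro _ u Gu).
have [[_ _ GM GV] _] := hG; have := GM _ _ Gu (GV _ Gv).
by rewrite /motion_mul/= mulmxV// mulmxN mulmxA mulmxV// mul1mx.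
Qed.

Lemma orthogonal_entry_le1 (d : 'M[R]_m) i j :
  orthogonal_mx d -> `|d i j| <= 1.
Proof.
move=> /(congr1 (fun M : 'M[R]_m => M j j)); rewrite !mxE eqxx (bigD1 i)//=.
rewrite mxE -expr2 => dij.
rewrite -(@expr_le1 _ 2)// -normrX ger0_norm ?sqr_ge0//.
by rewrite -[leRHS]dij lerDl sumr_ge0// => k _; rewrite mxE -expr2 sqr_ge0.
Qed.

(** In a basis B of the lattice, d becomes the integer matrix B^-1 d B, whose
    entries are bounded because those of an orthogonal matrix are at most 1 in
    absolute value. *)
Lemma finite_point_group : finite_set point_group.
Proof.
have [[sub _ _ _] /is_latticeP[B Bu LB]] := hG.
pose k0 i j : R := \sum_l \sum_k `|invmx B i k| * `|B l j|.
pose K0 : R := \sum_i \sum_j k0 i j.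
have [K K0K] : exists K : nat, K0 <= K%:R.
  by exists (Num.bound `|K0|); rewrite ltW//
    (le_lt_trans (ler_norm _))// archi_boundP.
(* The ordinals up to 2 K encode the integers from - K to K, shifted by K. *)
pose f (A : 'M['I_(K + K).+1]_m) : 'M[R]_m :=
  B *m (\matrix_(i, j) ((A i j)%:R - K%:R)) *m invmx B.
apply: (@sub_finite_set _ _ (f @` setT)); last exact/finite_image/finite_finset.
move=> d Jd.
have [M ME] : exists M : 'M[int]_m, d *m B = B *m intmx M.
  have : forall j, exists c : 'cV[int]_m, d *m col j B = B *m intmx c.
    move=> j; have := @point_group_lattice d (col j B) Jd; rewrite LB; apply.
    exists (delta_mx j 0); rewrite map_delta_mx -colE.
    by [].
  move=> /choice[c cE]; exists (\matrix_(i, j) c j i 0).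
  apply/matrixP => i j; have /colP/(_ i) := cE j.
  rewrite !mxE => dE; transitivity (\sum_k d i k * (col j B) k 0).
    by apply: eq_bigr => k _; rewrite mxE.
  by rewrite dE; apply: eq_bigr => k _; rewrite !mxE.
have MK i j : `|M i j| <= K%:Z.
  rewrite -(ler_int R) intr_norm; apply: le_trans K0K.
  have -> : (M i j)%:~R = (invmx B *m d *m B) i j.
    by rewrite -mulmxA ME mulKmx// mxE.
  have k00 i' j' : 0 <= k0 i' j'.
    by apply: sumr_ge0 => l _; apply: sumr_ge0 => k _; rewrite mulr_ge0.
  apply: (@le_trans _ _ (k0 i j)); last first.
    rewrite /K0 (bigD1 i)//= (bigD1 j)//= -addrA lerDl addr_ge0//.
      exact: sumr_ge0.
    by apply: sumr_ge0 => i' _; exact: sumr_ge0.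
  rewrite mxE (le_trans (ler_norm_sum _ _ _))//; apply: ler_sum => l _.
  rewrite mxE mulr_suml (le_trans (ler_norm_sum _ _ _))//.
  apply: ler_sum => k _; rewrite !normrM ler_wpM2r// ler_piMr//.
  by apply: orthogonal_entry_le1; case: Jd => v /sub.
exists (\matrix_(i, j) inord (absz (M i j + K%:Z))) => //.
rewrite /f -[RHS](mulmxK Bu) ME; congr (_ *m _ *m _).
apply/matrixP => i j; rewrite !mxE.
have := MK i j; rewrite ler_norml => /andP[M1 M2].
have MK0 : 0 <= M i j + K%:Z by rewrite -lerBlDr sub0r.
rewrite inordK; last first.
  rewrite ltnS -lez_nat gez0_abs// PoszD lerD2r.
  by [].
rewrite -[_%:R]/((absz (M i j + K%:Z))%:Z%:~R) gez0_abs// rmorphD/=.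
by rewrite -pmulrn addrK.
Qed.

(** G is the union, over the finite point group, of cosets of the lattice. *)
Lemma countable_crystallographic : countable G.
Proof.
have [_ /is_latticeP[B _ LB]] := hG.
have [v vG] := point_group_section.
pose F d (c : 'cV[int]_m) : motion R m := (v d + B *m intmx c, d).
apply: (@sub_countable _ _ _ (\bigcup_(d in point_group) (F d @` setT))).
  apply: subset_card_le => -[w d] Gwd.
  have Jd : point_group d by exists w.
  exists d => //; have := lattice_diff Gwd (vG _ Jd); rewrite LB => -[c cE].
  by exists c => //; rewrite /F -cE addrC subrK.
apply: bigcup_countable; first exact/finite_set_countable/finite_point_group.
move=> d _; apply: sub_countable (card_image_le _ _) _.
exact: countableP.
Qed.

End PointGroup.

Section Sigma.
Variables (R : realType) (n : nat).
Implicit Types d : 'M[R]_n.+1.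

(** The first n rows of d are those of the identity; the last row is orthogonal
    to them, hence of the form (0, y), and it has norm 1, so y is 1 or -1. *)
Lemma orthogonal_fix_proj d : orthogonal_mx d ->
  (forall i, row (lift ord_max i) (d - 1%:M) = 0) -> d = 1%:M \/ d = sigma R n.
Proof.
move=> /mulmx1C dd dfix.
have dE i j : d (lift ord_max i) j = (lift ord_max i == j)%:R.
  have /rowP/(_ j) := dfix i; rewrite !mxE => /eqP.
  by rewrite subr_eq0 => /eqP.
have dl i : d ord_max (lift ord_max i) = 0.
  have /matrixP/(_ ord_max (lift ord_max i)) := dd.
  rewrite !mxE (negPf (neq_lift _ _)) mulr0n => <-.
  rewrite (bigD1 (lift ord_max i))//= mxE dE eqxx mulr1 big1 ?addr0//.
  by move=> j ji; rewrite mxE dE eq_sym (negPf ji) mulr0.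
have : d ord_max ord_max ^+ 2 = 1.
  have /matrixP/(_ ord_max ord_max) := dd.
  rewrite !mxE eqxx mulr1n => <-.
  rewrite (bigD1 ord_max)//= mxE -expr2 big1 ?addr0//.
  by move=> j; case: (unliftP ord_max j) => [k ->|->]; rewrite ?eqxx// dl mul0r.
move=> /eqP; rewrite sqrf_eq1 => /orP[] /eqP dmm; [left|right];
  apply/matrixP => i j; rewrite !mxE;
  case: (unliftP ord_max i) => [i' ->|->]; rewrite ?dE//.
- by case: (unliftP ord_max j) => [j' ->|->]; rewrite ?dl ?dmm ?eqxx//
    (negPf (neq_lift _ _)).
- by rewrite [lift _ _ == ord_max]eq_sym (negPf (neq_lift _ _)).
- case: (unliftP ord_max j) => [j' ->|->].
    by rewrite dl (negPf (neq_lift _ _)) mulr0n.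
  by rewrite !eqxx dmm.
Qed.

End Sigma.

(** * Invariant functions and their periods *)

Section Invariants.
Variables (R : realType) (n : nat) (G : set (motion R n.+1)).
Hypothesis hG : crystallographic G.
Implicit Types f : 'cV[R]_n.+1 -> R.

Lemma pt_add (v : 'cV[R]_n.+1) x y :
  v + pt x y = pt (x + projx v) (y + v ord_max 0).
Proof.
apply/colP => i; rewrite !mxE; case: (unliftP ord_max i) => [j ->|->].
  by rewrite !mxE addrC.
by rewrite addrC.
Qed.

Lemma invariant_act f g z : invariant_functions G f -> G g -> f (act g z) = f z.
Proof.
move=> [_ finv] Gg; rewrite -(finv g Gg) act_inv//.
by have [[sub _ _ _] _] := hG; exact: sub.
Qed.

Lemma continuous_vertical f x : C1 f -> continuous (fun y => f (pt x y)).
Proof.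
move=> fC1; pose e : 'cV[R]_n.+1 := delta_mx ord_max 0.
have ptE y : pt x y = pt x 0 + y *: e.
  apply/colP => i; rewrite !mxE; case: (unliftP ord_max i) => [j ->|->].
    by rewrite [lift _ _ == _]eq_sym (negPf (neq_lift _ _)) mulr0 addr0.
  by rewrite eqxx mulr1 add0r.
have cpt : continuous (fun y : R => pt x 0 + y *: e : 'cV[R]_n.+1).
  move=> y; apply: cvgD; first exact: cvg_cst.
  by apply: cvgZr_tmp; exact: cvg_id.
under eq_fun do rewrite ptE.
have : continuous (f \o (fun y : R => pt x 0 + y *: e : 'cV[R]_n.+1)).
  by move=> y; apply: continuous_comp; [exact: cpt|exact: C1_continuous].
exact.
Qed.

Lemma invariant_vertical_period f y0 x y : lattice_of G (pt 0 y0) ->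
  invariant_functions G f -> f (pt x (y + y0)) = f (pt x y).
Proof.
move=> Ly0 fX; rewrite -[RHS](invariant_act _ fX Ly0) /act/= mul1mx pt_add.
by rewrite projx_pt addr0 pt_last.
Qed.

Lemma lattice_common_period y0 v : 0 < y0 -> lattice_of G (pt 0 y0) ->
  lattice_of G v -> common_periods G y0 (projx v).
Proof.
move=> y00 Ly0 Lv x _ [f fX <-].
have cf : continuous (fun y => f (pt x y)).
  by apply: continuous_vertical; case: fX.
have fper y := invariant_vertical_period x y Ly0 fX.
rewrite /Pi -[RHS](Rintegral_periodic (- v ord_max 0) y00 cf fper).
apply: eq_Rintegral => y _.
by rewrite -[RHS](invariant_act _ fX Lv) /act/= mul1mx pt_add subrK.
Qed.

Lemma sigma_common_period y0 w : 0 < y0 -> lattice_of G (pt 0 y0) ->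
  G (w, sigma R n) -> common_periods G y0 (projx w).
Proof.
move=> y00 Ly0 Gw x _ [f fX <-].
have cf : continuous (fun y => f (pt x y)).
  by apply: continuous_vertical; case: fX.
have fper y := invariant_vertical_period x y Ly0 fX.
rewrite /Pi -[RHS](Rintegral_periodic_reflect (w ord_max 0) y00 cf fper).
apply: eq_Rintegral => y _.
by rewrite -[RHS](invariant_act _ fX Gw) /act/= sigma_pt pt_add opprB subrK.
Qed.

(** Averaging over coset representatives of G modulo its translations: since
    psi is periodic, the summand does not depend on the choice of the
    representative (v d, d), and an element of G with linear part e permutes
    the summands through d |-> e d. *)
Lemma invariant_sum (v : 'M[R]_n.+1 -> 'cV[R]_n.+1) (psi : 'cV[R]_n.+1 -> R) :
  (forall d, point_group G d -> G (v d, d)) ->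
  (forall z l, lattice_of G l -> psi (z + l) = psi z) ->
  (forall d, C1 (fun z => psi (invmx d *m (z - v d)))) ->
  invariant_functions G
    (fun z => \sum_(d \in point_group G) psi (invmx d *m (z - v d))).
Proof.
move=> vG psiper psiC1; split.
  rewrite (_ : (fun z => _) = (fun z =>
      \sum_(d <- finmap.enum_fset (fset_set (point_group G)))
        psi (invmx d *m (z - v d)))); first exact: C1_sum.
  by apply/funext => z; rewrite fsbig_finite//; exact: finite_point_group.
move=> [w e] Gwe z; have [[sub _ GM _] _] := hG.
have Je : point_group G e by exists w.
have eu := point_group_unit hG Je.
rewrite [RHS](reindex_fsbig (mulmx e) (point_group G)); last first.
  split=> [d [u Gud]|d1 d2 _ _|d [u Gud]].
  - by exists (w + e *m u); exact: (GM _ _ Gwe Gud).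
  - exact: (can_inj (mulKmx eu)).
  - exists (invmx e *m d); last by rewrite mulKVmx.
    have [u' Gu'] := point_group_inv hG Je.
    by exists (u' + invmx e *m u); exact: (GM _ _ Gu' Gud).
apply: eq_fsbigr => d /set_mem Jd.
have du := point_group_unit hG Jd.
have Ged := GM _ _ Gwe (vG _ Jd).
have Jed : point_group G (e *m d) by exists (w + e *m v d).
rewrite act_invE/=.
rewrite -[RHS](psiper _ (invmx (e *m d) *m (v (e *m d) - (w + e *m v d))));
  last first.
  apply: point_group_lattice => //; first exact: point_group_inv.
  exact: lattice_diff (vG _ Jed) Ged.
congr psi; rewrite -mulmxDr addrA subrK.
rewrite [invmx (e *m d)](@invrM 'M[R]_n.+1 e d eu du) -mulmxA.
by congr (_ *m _); rewrite opprD addrA [RHS]mulmxBr mulKmx.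
Qed.

End Invariants.

(** * A periodic function vanishing exactly on a lattice *)

Section TorusGap.
Variable R : realType.
Local Notation intmx := (map_mx (intr : int -> R)).

Lemma sqr_sin_piD (x : R) (k : int) :
  sin (pi * (x + k%:~R)) ^+ 2 = sin (pi * x) ^+ 2.
Proof.
have stepn (y : R) (j : nat) : sin (pi * (y + j%:R)) ^+ 2 = sin (pi * y) ^+ 2.
  elim: j => [|j IHj]; first by rewrite addr0.
  by rewrite -natr1 addrA mulrDr mulr1 sinDpi sqrrN.
case: k => j; first exact: stepn.
by rewrite -[in RHS](subrK j.+1%:R x) stepn NegzE rmorphN.
Qed.

(** The fractional part t of x satisfies 0 <= t < 1, and sin (pi t) is positive
    for 0 < t < 1. *)
Lemma sin_pi_eq0 (x : R) : sin (pi * x) = 0 -> exists k : int, x = k%:~R.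
Proof.
move=> sx0; exists (Num.floor x).
pose t := x - (Num.floor x)%:~R.
have xE : x = t + (Num.floor x)%:~R by rewrite /t subrK.
have : sin (pi * t) ^+ 2 = 0.
  by rewrite -(sqr_sin_piD _ (Num.floor x)) -xE sx0 expr0n.
move=> /eqP; rewrite sqrf_eq0 => /eqP st0.
have t0 : 0 <= t by rewrite subr_ge0 floor_le_tmp.
have t1 : t < 1.
  by rewrite ltrBlDl -[1]/(1%:~R) -intrD floorD1_gt.
move: t0; rewrite le_eqVlt => /predU1P[t0|t0].
  by rewrite {1}xE -t0 add0r.
have : 0 < sin (pi * t).
  by apply: sin_gt0_pi; rewrite mulr_gt0 ?pi_gt0//= gtr_pMr// pi_gt0.
by rewrite st0 ltxx.
Qed.

Variable m : nat.
Implicit Type B : 'M[R]_m.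

(** A smooth substitute for the squared distance from z to the lattice with
    basis B. *)
Definition torus_gap B (z : 'cV[R]_m) : R :=
  \sum_i sin (pi * (invmx B *m z) i 0) ^+ 2.

Lemma torus_gap_ge0 B z : 0 <= torus_gap B z.
Proof. by apply: sumr_ge0 => i _; exact: sqr_ge0. Qed.

Lemma torus_gapD B z l : B \in unitmx -> span_int B l ->
  torus_gap B (z + l) = torus_gap B z.
Proof.
move=> Bu [c ->]; apply: eq_bigr => i _.
by rewrite mulmxDr mulKmx// mxE [intmx c i 0]mxE sqr_sin_piD.
Qed.

Lemma torus_gap_eq0 B z : B \in unitmx -> torus_gap B z = 0 -> span_int B z.
Proof.
move=> Bu /eqP; rewrite psumr_eq0 => [/allP gap0|i _]; last exact: sqr_ge0.
have : forall i, exists k : int, (invmx B *m z) i 0 = k%:~R.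
  move=> i; apply: sin_pi_eq0; apply/eqP; rewrite -sqrf_eq0.
  exact: gap0 (mem_index_enum i).
move=> /choice[k kE]; exists (\col_i k i).
rewrite -[LHS](mulKVmx Bu); congr (_ *m _).
by apply/colP => i; rewrite kE !mxE.
Qed.

End TorusGap.

Lemma C1_torus_gap (R : realType) n (B M : 'M[R]_n.+1) a :
  C1 (fun z : 'cV[R]_n.+1 => torus_gap B (M *m z + a)).
Proof.
apply: C1_sum => i.
pose c : R := (invmx B *m a) i 0.
have E z : (invmx B *m (M *m z + a)) i 0 = c + (row i (invmx B *m M) *m z) 0 0.
  by rewrite mulmxDr mxE addrC mulmxA -row_mul [in RHS]mxE.
under eq_fun do rewrite E.
pose s (t : R) : R := sin (pi * t) ^+ 2.
pose s' (t : R) : R := 2 * sin (pi * t) * (cos (pi * t) * pi).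
have ds t : is_derive t (1 : R) s (s' t).
  have d1 : is_derive t (1 : R) (fun x : R => pi * x) pi.
    by apply: is_derive_eq; exact: mulr1.
  have d2 := is_derive1_comp (is_derive_sin (pi * t)) d1.
  have d3 := @is_deriveX _ _ (sin \o (fun x : R => pi * x)) 1 t 1 _ d2.
  apply: is_derive_eq.
  by rewrite /= expr0 mulr1 !scale1r /s' -mulrA mulr_natl mulr2n.
have cs' : continuous s'.
  have cpi : continuous (fun x : R => pi * x).
    by move=> x; apply: cvgM; [exact: cvg_cst|exact: cvg_id].
  have csin : continuous (sin \o (fun x : R => pi * x)).
    by move=> x; apply: continuous_comp; [exact: cpi|exact: continuous_sin].
  have ccos : continuous (cos \o (fun x : R => pi * x)).
    by move=> x; apply: continuous_comp; [exact: cpi|exact: continuous_cos].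
  move=> t; apply: cvgM.
    by apply: cvgM; [exact: cvg_cst|exact: csin].
  by apply: cvgM; [exact: ccos|exact: cvg_cst].
exact: (C1_comp ds cs' (C1_affine _ _)).
Qed.

(** * Separating a line from an orbit *)

Lemma finite_common_bound (R : realType) (T : eqType) (s : seq T)
    (P : T -> R -> Prop) :
  (forall x, x \in s -> exists2 e, 0 < e & P x e) ->
  (forall x e e', 0 < e' <= e -> P x e -> P x e') ->
  exists2 e, 0 < e & forall x, x \in s -> P x e.
Proof.
move=> ex down; elim: s => [|x s IHs] in ex *; first by exists 1.
have [y ys|e1 e10 Pe1] := IHs; first by apply: ex; rewrite inE ys orbT.
have [e2 e20 Pe2] := ex x (mem_head _ _).
have e0 : 0 < Num.min e1 e2 by rewrite lt_min e10.
exists (Num.min e1 e2) => // y; rewrite inE => /predU1P[->|ys].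
  by apply: down Pe2; rewrite e0 ge_min lexx orbT.
by apply: down (Pe1 _ ys); rewrite e0 ge_min lexx.
Qed.

Section Separation.
Variables (R : realType) (n : nat) (G : set (motion R n.+1)).
Hypothesis hG : crystallographic G.

(** The invariant function sum over d of cutoff (e - gap d z), where gap d z
    measures how far g_d^-1 z is from z0 modulo the lattice, contradicts the
    period p.  Above projx z0 + p every gap is positive because the line avoids
    the orbit of z0, hence at least some e > 0 on the compact segment, and the
    function vanishes there.  Above projx z0 it is positive at z0 itself,
    through the term d = 1. *)
Lemma orbit_separation (y0 : R) (p : 'cV[R]_n) (z0 : 'cV[R]_n.+1) :
  0 < z0 ord_max 0 < y0 ->
  (forall g, G g -> projx (act g z0) <> projx z0 + p) ->
  ~ common_periods G y0 p.
Proof.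
move=> z0y away per.
have y0gt0 : 0 < y0 by case/andP: z0y; exact: lt_trans.
have [[_ G1 GM _] /is_latticeP[B Bu LB]] := hG.
have [v vG] := point_group_section G.
pose gap d z := torus_gap B (invmx d *m (z - v d) - z0).
have gapC1 d : C1 (gap d).
  rewrite (_ : gap d = fun z =>
      torus_gap B (invmx d *m z + (- (invmx d *m v d) - z0))).
    exact: C1_torus_gap.
  by apply/funext => z; rewrite /gap mulmxBr addrA.
have Jfin := finite_point_group hG.
have memJ d : (d \in finmap.enum_fset (fset_set (point_group G))) =
    (d \in point_group G).
  by rewrite -(in_fset_set Jfin).
have [e e0 egap] : exists2 e, 0 < e &
    forall d, d \in finmap.enum_fset (fset_set (point_group G)) ->
    forall y, 0 <= y <= y0 -> e <= gap d (pt (projx z0 + p) y).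
  apply: finite_common_bound => [d|d e e' /andP[_ ee'] He y /He];
    last exact: le_trans.
  rewrite memJ => /set_mem Jd.
  have cg := @continuous_vertical _ _ _ (projx z0 + p) (gapC1 d).
  have [c _ cmin] := EVT_min (ltW y0gt0) (continuous_subspaceT cg).
  exists (gap d (pt (projx z0 + p) c)); last first.
    by move=> y yI; apply: cmin; rewrite in_itv.
  rewrite lt0r torus_gap_ge0 andbT; apply/eqP => /(torus_gap_eq0 Bu).
  rewrite -LB => Gl; have := GM _ _ (vG _ Jd) Gl.
  set l := (_ - z0) => Gg; apply: (away _ Gg).
  rewrite /act/= mulmx1 /l -addrA -mulmxDr subrK.
  by rewrite mulKVmx ?(point_group_unit hG)// addrC subrK projx_pt.
pose psi z := cutoff (e - torus_gap B (z - z0)).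
have fX : invariant_functions G
    (fun z => \sum_(d \in point_group G) psi (invmx d *m (z - v d))).
  apply: (invariant_sum hG vG) => [z l Ll|d].
    by rewrite /psi addrAC torus_gapD// -LB.
  apply: C1_cutoff.
  have dN t : is_derive t (1 : R) (fun x : R => e - x) (-1).
    by apply: is_derive_eq; rewrite add0r mul1r.
  have cN : continuous (cst (-1) : R -> R) by exact: cst_continuous.
  exact: (@C1_comp _ _ (fun x => e - x) (cst (-1)) _ dN cN (gapC1 d)).
set f := (fun z => _) in fX.
have := per (projx z0) _ (imageP (Pi y0) fX).
rewrite /Pi.
rewrite [LHS](_ : _ = 0); last first.
  rewrite (@eq_Rintegral _ _ _ _ _ (cst 0)).
    by rewrite Rintegral_cst// mul0r.
  move=> y; rewrite inE/= in_itv/= => yI; rewrite /f fsbig1// => d Jd.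
  apply: cutoff_eq0; rewrite subr_le0; apply: egap => //.
  by rewrite memJ mem_set.
(* The integral above projx z0 is positive: the integrand is so at z0. *)
apply/eqP; rewrite eq_sym gt_eqF//.
apply: (@Rintegral_gt0 _ _ _ (z0 ord_max 0)) => //.
- by apply: continuous_vertical; case: fX.
- by move=> y; apply: fsumr_ge0 => d _; exact: cutoff_ge0.
have J1 : point_group G 1%:M by exists 0.
rewrite pt_eta /f (fsbigD1 1%:M)//= ltr_pwDl//; last first.
  by apply: fsumr_ge0 => d _; exact: cutoff_ge0.
rewrite cutoff_gt0// subr_gt0 invmx1 mul1mx addrAC subrr sub0r.
rewrite -[- v _]add0r torus_gapD//.
  by rewrite /torus_gap big1// => i _; rewrite mulmx0 mxE mulr0 sin0 expr0n.
rewrite -LB -[- v _]add0r; exact: (lattice_diff hG G1 (vG _ J1)).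
Qed.

(** An element (v, d) of G moves z0 onto the line above projx z0 + p when, for
    each i < n, row i of (d - 1) z0 equals entry i of p - v.  A nonzero row
    defines a hyperplane that a generic z0 avoids; if all rows vanish then d is
    1 or sigma and p is projx v. *)
Lemma generic_orbit (y0 : R) (p : 'cV[R]_n) : 0 < y0 ->
  ([set projx v | v in lattice_of G] `|` [set projx w | w in lattice_sigma G]) p
  \/ exists2 z0 : 'cV[R]_n.+1, 0 < z0 ord_max 0 < y0 &
        forall g, G g -> projx (act g z0) <> projx z0 + p.
Proof.
move=> y00; have [[sub G1 _ _] _] := hG.
have [inp|np] := pselect (([set projx v | v in lattice_of G] `|`
  [set projx w | w in lattice_sigma G]) p); [by left|right].
pose eqn (gi : motion R n.+1 * 'I_n) : 'rV[R]_n.+1 * R :=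
  (row (lift ord_max gi.2) (gi.1.2 - 1%:M),
   p gi.2 0 - gi.1.1 (lift ord_max gi.2) 0).
pose S := [set uc | uc.1 != 0] `&` (eqn @` (G `*` setT)).
have Scnt : countable S.
  apply: (@sub_countable _ _ _ (eqn @` (G `*` setT))).
    by apply: subset_card_le => uc [].
  apply: sub_countable (card_image_le _ _) _.
  by apply: countableX => //; exact: countable_crystallographic.
(* With t < 1 and t < y0, the last coordinate t ^+ n.+1 lies in ]0, y0[. *)
have T0 : 0 < Num.min 1 y0 by rewrite lt_min ltr01.
have [t /andP[t0 tT] tS] :=
  generic_moment_curve Scnt (fun uc (Suc : S uc) => Suc.1) T0.
have /andP[t1 ty0] : (t < 1) && (t < y0) by rewrite -lt_min.
exists (moment_curve n.+1 t).
  rewrite mxE exprn_gt0//= (le_lt_trans _ ty0)//.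
  by rewrite -[leRHS]expr1 ler_wiXn2l// ltW.
move=> [v d] Gg /= gz; set z0 := moment_curve n.+1 t in gz tS *.
have rowz i : (row (lift ord_max i) (d - 1%:M) *m z0) 0 0 =
    p i 0 - v (lift ord_max i) 0.
  move: gz => /colP/(_ i); rewrite /act/= -row_mul mulmxBl mul1mx !mxE.
  by move=> E; lra.
have fixd i : row (lift ord_max i) (d - 1%:M) = 0.
  apply: contrapT => /eqP nz; have /tS : S (eqn ((v, d), i)).
    by split => //; exists ((v, d), i).
  by rewrite /= rowz eqxx.
have pE : p = projx v.
  apply/colP => i; have := rowz i; rewrite fixd mul0mx !mxE => /eqP.
  by rewrite eq_sym subr_eq0 => /eqP.
apply: np; rewrite pE; have [d1|ds] := orthogonal_fix_proj (sub _ Gg) fixd.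
  by left; exists v => //; rewrite /lattice_of/= -d1.
right; exists v => //; exists v; rewrite -ds; split=> //.
by exists 0; rewrite addr0.
Qed.

End Separation.

Unset Implicit Arguments.

Theorem lemma5p1 (R : realType) (n : nat) (hn : (1 <= n)%N)
  (G : set (motion R n.+1)) (hG : crystallographic G)
  (y0 : R) (hy0 : 0 < y0) (hL : lattice_of G (pt 0 y0)) :
  is_lattice (common_periods G y0) /\
  common_periods G y0 =
    [set projx v | v in lattice_of G] `|` [set projx w | w in lattice_sigma G].
Proof.
have [[_ _ GM _] Llat] := hG.
have perE : common_periods G y0 =
    [set projx v | v in lattice_of G] `|` [set projx w | w in lattice_sigma G].
  apply/seteqP; split=> p.
    move=> per; have [//|[z0 z0y away]] := generic_orbit hG p hy0.
    by have := orbit_separation hG z0y away per.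
  move=> [[v Lv <-]|[_ [v [Gv [l [Gl ->]]]] <-]].
    exact: lattice_common_period.
  apply: (sigma_common_period hG) => //.
  have := GM _ _ Gl Gv; rewrite /motion_mul/= !mul1mx addrC.
  by [].
split=> //; rewrite perE.
have projD (u v : 'cV[R]_n.+1) : projx (u + v) = projx u + projx v.
  by apply/colP => i; rewrite !mxE.
have PLlat := lattice_projx Llat (lt0r_neq0 hy0) hL.
have [[w Gw]|nos] := pselect (exists w, G (w, sigma R n)); last first.
  rewrite (_ : lattice_sigma G = set0) ?image_set0 ?setU0//.
  by apply/seteqP; split=> // x [v [Gv _]]; apply: nos; exists v.
have -> : [set projx w | w in lattice_sigma G] =
    [set projx w + l | l in [set projx v | v in lattice_of G]].
  apply/seteqP; split=> [_ [_ [v [Gv [l [Gl ->]]]] <-]|_ [_ [l Gl <-] <-]].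
    exists (projx (v - w + l)); last by rewrite -projD addrA subrKC.
    exists (v - w + l) => //; have := GM _ _ (lattice_diff hG Gv Gw) Gl.
    by rewrite /motion_mul/= !mul1mx.
  exists (w + l); last exact: projD.
  by exists w; split=> //; exists l.
apply: lattice_setU_half => //.
exists (w + sigma R n *m w).
  have := GM _ _ Gw Gw; rewrite /motion_mul/=.
  rewrite (_ : sigma R n *m sigma R n = 1%:M)//.
  apply/matrixP => i j; rewrite mul_diag_mx !mxE.
  case: (eqVneq i j) => _; rewrite ?mulr1n ?mulr0n ?mulr0 //.
  by case: ifP => _; rewrite ?mulrNN mulr1.
by rewrite projD -{2}[w]pt_eta sigma_pt projx_pt.
Qed.
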